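(* Let $V$ be a 3-dimensional complex vector space with a Hermitian form $h$ of signature $(2,1)$. Let $z_1,z_2,z_3\in V$ be linearly independent non-null vectors such that the restrictions of $h$ to $\langle z_1,z_2\rangle$ and $\langle z_2,z_3\rangle$ are nondegenerate. Put $a_i=h(z_i,z_i)$, $h_{ij}=h(z_i,z_j)$, $\Delta_{ij}=a_ia_j-|h_{ij}|^2$, $q_{ij}=\Delta_{ij}/(a_ia_j)$, $D_{123}=\det(h_{ij})_{1\le i,j\le3}$, $\Omega_{123}=\dfrac{h_{12}h_{23}h_{31}}{a_1a_2a_3}$, $\Theta_{123}=\Omega_{123}+\overline{\Omega_{123}}$. Let $p_3\neq0$ satisfy $h(p_3,z_1)=h(p_3,z_2)=0$ and $p_1\neq 0$ satisfy $h(p_1,z_2)=h(p_1,z_3)=0$, with $p_1,p_3$ non-null, and let $$s_2=1-\frac{|h(p_3,p_1)|^2}{h(p_3,p_3)h(p_1,p_1)}$$ be the vertex spread at $z_2$. Then $$q_{12}\,q_{23}\,s_2=q_{12}+q_{23}+q_{31}-2+\Theta_{123}.$$ Equivalently, in denominator-cleared form, $$\Delta_{12}\,\Delta_{23}\,s_2=a_2\,D_{123}.$$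
   Context: $h$ is linear in the first argument and conjugate-linear in the second; a vector $z$ is non-null if $h(z,z)\neq0$. *)

(* Defs.v *)
From mathcomp Require Import all_boot all_order all_algebra.
From mathcomp Require Import complex reals.

Set Implicit Arguments.
Unset Strict Implicit.
Unset Printing Implicit Defensive.

Import GRing.Theory Num.Theory Num.Def.
Local Open Scope ring_scope.

(* Linear in the first argument, conjugate-linear in the second; the flag
   [false] selects h u v = (h v u)^* rather than the skew-Hermitian rule. *)
Notation hermitian_form C V := ({hermitian V for false & @conjC C}).

Section HermitianForms.
Variables (C : numClosedFieldType) (V : vectType C) (h : hermitian_form C V).

Definition gram n (e : n.-tuple V) : 'M[C]_n :=
  \matrix_(i, j) h (tnth e i) (tnth e j).

Definition signature_of (p q : nat) : Prop :=
  exists2 e : (p + q).-tuple V,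
    basis_of fullv e & gram e = block_mx 1%:M 0 0 (- 1%:M).

Definition nonnull (x : V) : bool := h x x != 0.

(* The radical of h restricted to W is W :&: orthov h W; for W = fullv this is
   the library's [nondegenerate]. *)
Definition nondegenerate_on (W : {vspace V}) : bool :=
  (W :&: orthov h W == 0)%VS.

(* All scalars below live in C, including the real-valued ones: the norm `|_|
   of a numClosedFieldType takes its values in the field itself. *)
Definition Delta (x y : V) : C := h x x * h y y - `|h x y| ^+ 2.

Definition qspread (x y : V) : C := Delta x y / (h x x * h y y).

Definition Omega (x y z : V) : C :=
  (h x y * h y z * h z x) / (h x x * h y y * h z z).

Definition Theta (x y z : V) : C := Omega x y z + (Omega x y z)^*.

End HermitianForms.

(* Main.v *)
Require Import Defs.
From mathcomp Require Import all_boot all_order all_algebra.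
From mathcomp Require Import complex reals.
From mathcomp Require Import ring.
Import GRing.Theory Num.Theory Num.Def.
Local Open Scope ring_scope.

(** Write [p3 = a z1 + b z2 + c z3].  Cramer's rule on the two orthogonality
    relations gives [Delta12 a = c K] and [Delta12 h(p3,z3) = c D], where
    [K = h32 h21 - a2 h31]; symmetrically for [p1].  The only component of [p3]
    contributing to [h(p3,p3)] is [c z3], and the only one contributing to
    [h(p3,p1)] is [a z1], so that
    [|h(p3,p1)|^2 / (h(p3,p3) h(p1,p1)) = |K|^2 / (Delta12 Delta23)].  The
    theorem is then Jacobi's identity [Delta12 Delta23 - |K|^2 = a2 D]. *)

Lemma mem_span3 (K : fieldType) (V : vectType K) (x y z v : V) :
  v \in <<[:: x; y; z]>>%VS ->
  exists a b c : K, v = a *: x + b *: y + c *: z.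
Proof.
rewrite !span_cons span_nil addv0.
move=> /memv_addP[u /vlineP[a ->] [w /memv_addP[u' /vlineP[b ->]]]].
by move=> [w' /vlineP[c ->] ->] ->; exists a, b, c; rewrite addrA.
Qed.

Lemma det_mx33 (R : comNzRingType) (A : 'M[R]_3) :
  let i1 : 'I_3 := lift ord0 ord0 in let i2 : 'I_3 := lift ord0 (lift ord0 ord0) in
  \det A = A ord0 ord0 * (A i1 i1 * A i2 i2 - A i1 i2 * A i2 i1)
         - A ord0 i1 * (A i1 ord0 * A i2 i2 - A i1 i2 * A i2 ord0)
         + A ord0 i2 * (A i1 ord0 * A i2 i1 - A i1 i1 * A i2 ord0).
Proof.
(* Cofactor minors index entries by nested lifts; these equations reduce them to the three indices
   of the statement. *)
have e1 : lift (lift ord0 ord0) ord0 = ord0 :> 'I_3 by apply/val_inj.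
have e2 : lift (lift ord0 ord0) (lift ord0 ord0) = lift ord0 (lift ord0 ord0)
  :> 'I_3 by apply/val_inj.
have e3 : lift (lift ord0 (lift ord0 ord0)) ord0 = ord0 :> 'I_3 by apply/val_inj.
have e4 : lift (lift ord0 (lift ord0 ord0)) (lift ord0 ord0) = lift ord0 ord0
  :> 'I_3 by apply/val_inj.
have f1 : lift (lift ord0 ord0) ord0 = ord0 :> 'I_2 by apply/val_inj.
rewrite (expand_det_row _ ord0) !big_ord_recl big_ord0 /cofactor.
rewrite !(expand_det_row _ ord0) !big_ord_recl !big_ord0 /cofactor !det_mx11.
rewrite !mxE /= ?e1 ?e2 ?e3 ?e4 ?f1 ?e1 ?e2 ?e3 ?e4 /bump /=.
ring.
Qed.

Section HermitianThreeSpace.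
Variables (C : numClosedFieldType) (V : vectType C) (h : hermitian_form C V).
Implicit Types u v w x y z p : V.

Lemma formC u v : h u v = (h v u)^*.
Proof. by rewrite hermC expr0 mul1r. Qed.

Lemma form_lin3l a b c x y z v :
  h (a *: x + b *: y + c *: z) v = a * h x v + b * h y v + c * h z v.
Proof. by rewrite !linearDl !linearZl_LR. Qed.

Lemma form_lin3r a b c x y z v :
  h v (a *: x + b *: y + c *: z) = a^* * h v x + b^* * h v y + c^* * h v z.
Proof. by rewrite !linearDr !linearZr_LR. Qed.

(** Trading the squared modulus for a product of form values makes later identities polynomial,
    within reach of [ring]. *)
Lemma DeltaE x y : Delta h x y = h x x * h y y - h x y * h y x.
Proof. by rewrite /Delta normCK -formC. Qed.

Lemma DeltaC x y : Delta h x y = Delta h y x.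
Proof. by rewrite !DeltaE; ring. Qed.

Lemma Delta_real x y : (Delta h x y)^* = Delta h x y.
Proof. by rewrite DeltaE rmorphB !rmorphM /= -!formC; ring. Qed.

Lemma Delta_neq0 x y : free [:: x; y] -> nonnull h y ->
  nondegenerate_on h <<[:: x; y]>>%VS -> Delta h x y != 0.
Proof.
(* [w] is [h y y] times the component of [x] orthogonal to [y], and [h w x] is [Delta h x y]; if
   that vanishes, [w] lies in the radical of the plane. *)
move=> fxy ynn nd; apply/eqP => D0; pose w := h y y *: x - h x y *: y.
have wo v : v \in [:: x; y] -> h w v = 0.
  rewrite /w linearBl !linearZl_LR !inE => /orP[]/eqP-> /=.
    by rewrite -D0 DeltaE; ring.
  by rewrite mulrC subrr.
have w_orth : w \in orthov h <<[:: x; y]>>.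
  apply/mem_orthovP => v; rewrite -[[:: x; y]]in_tupleE => /coord_span->.
  rewrite linear_sumr big1 // => i _.
  by rewrite linearZr_LR /= wo ?mulr0 // mem_nth.
have w_in : w \in <<[:: x; y]>>%VS.
  by rewrite /w memvB // memvZ // memv_span // !inE eqxx ?orbT.
have: w \in (<<[:: x; y]>> :&: orthov h <<[:: x; y]>>)%VS.
  by rewrite memv_cap w_in.
(* Nondegeneracy forces [w = 0]; dividing by [h y y] makes [x] a multiple of [y], against
   freeness. *)
rewrite (eqP nd) memv0 subr_eq0 => /eqP xy.
move: fxy; rewrite free_cons => /andP[/negP[]].
rewrite -[x](scalerK ynn) xy; apply: memvZ; apply: memvZ.
by rewrite memv_span ?inE.
Qed.

Definition gram_det x y z : C :=
  h x x * h y y * h z z - h x x * (h y z * h z y) - h y y * (h x z * h z x)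
  - h z z * (h x y * h y x) + h x y * h y z * h z x + h x z * h z y * h y x.

Lemma det_gram3 x y z : \det (gram h [tuple x; y; z]) = gram_det x y z.
Proof. rewrite det_mx33 !mxE !(tnth_nth 0) /= /gram_det; ring. Qed.

Lemma gram_detC x y z : gram_det z y x = gram_det x y z.
Proof. rewrite /gram_det; ring. Qed.

Lemma gram_det_real x y z : (gram_det x y z)^* = gram_det x y z.
Proof.
rewrite /gram_det !(rmorphB, rmorphD, rmorphM) /= -!formC; ring.
Qed.

Section Normal.
Variables (x y z p : V) (a b c : C).
Hypotheses (pE : p = a *: x + b *: y + c *: z).
Hypotheses (px : h p x = 0) (py : h p y = 0).

Lemma normal_coord : Delta h x y * a = c * (h z y * h y x - h y y * h z x).
Proof.
move: px py; rewrite pE !form_lin3l => qx qy.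
apply/eqP; rewrite -subr_eq0 DeltaE; apply/eqP.
(* The zeros stand for the two orthogonality relations; this combination eliminates [b]. *)
transitivity (h y y * 0 - h y x * 0); last by rewrite !mulr0 subrr.
by rewrite -{1}qx -qy; ring.
Qed.

Lemma normal_height : Delta h x y * h p z = c * gram_det x y z.
Proof.
move: px py; rewrite pE !form_lin3l => qx qy.
apply/eqP; rewrite -subr_eq0 DeltaE /gram_det; apply/eqP.
(* The brackets are the eliminations giving [a] and [b], weighted by the coefficients of [a] and [b]
   in [h p z]. *)
transitivity (h x z * (h y y * 0 - h y x * 0) + h y z * (h x x * 0 - h x y * 0)).
  by rewrite -{1 4}qx -qy; ring.
by rewrite !mulr0 !subrr !mulr0 addr0.
Qed.

Lemma normal_norm : h p p = c^* * h p z.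
Proof. by rewrite {2}pE form_lin3r px py !mulr0 !add0r. Qed.
End Normal.

Lemma spread_identity x y z p q :
  p \in <<[:: x; y; z]>>%VS -> q \in <<[:: x; y; z]>>%VS ->
  Delta h x y != 0 -> h p x = 0 -> h p y = 0 -> nonnull h p ->
  h q y = 0 -> h q z = 0 -> nonnull h q ->
  Delta h x y * Delta h y z * (1 - `|h p q| ^+ 2 / (h p p * h q q))
    = h y y * gram_det x y z.
Proof.
move=> /mem_span3[a [b [c pE]]] /mem_span3[c' [b' [a' qE]]] D12 px py pnn qy qz qnn.
(* [q] is normal to the plane of [z] and [y], so the [Normal] lemmas apply to it with [x] and [z]
   exchanged. *)
have qE' : q = a' *: z + b' *: y + c' *: x by rewrite qE addrC addrA addrAC.
have Ha := normal_coord _ _ _ _ _ _ _ pE px py.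
have Hc := normal_height _ _ _ _ _ _ _ pE px py.
have Hp := normal_norm _ _ _ _ _ _ _ pE px py.
have Hc' := normal_height _ _ _ _ _ _ _ qE' qz qy.
have Hq := normal_norm _ _ _ _ _ _ _ qE' qz qy.
rewrite DeltaC gram_detC in Hc'.
have Hc'J : Delta h y z * (h q x)^* = c'^* * gram_det x y z.
  by rewrite -(Delta_real y z) -(gram_det_real x y z) -!rmorphM Hc'.
set K := h z y * h y x - h y y * h z x in Ha.
have HaJ : Delta h x y * a^* = c^* * K^*.
  by rewrite -(Delta_real x y) -!rmorphM Ha.
have pq : h p q = a * (h q x)^*.
  rewrite pE form_lin3l (formC y q) (formC z q) qy qz conjC0 !mulr0 !addr0.
  by rewrite -formC.
have key : Delta h x y * Delta h y z * `|h p q| ^+ 2 = K * K^* * (h p p * h q q).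
  (* The extra factor [Delta h x y] lets both [a] and [a^*] be replaced by Cramer's rule; [Hc] then
     absorbs it again. *)
  apply: (mulfI D12); rewrite normCK pq rmorphM /= conjCK Hp Hq.
  transitivity ((Delta h x y * a) * (Delta h x y * a^*) *
                (Delta h y z * (h q x)^*) * h q x); first by ring.
  rewrite Ha HaJ Hc'J.
  transitivity (K * K^* * c^* * c'^* * h q x * (c * gram_det x y z)); first by ring.
  by rewrite -Hc; ring.
rewrite mulrBr mulr1 mulrA key mulfK ?mulf_neq0 //.
(* What remains is Jacobi's identity, polynomial in the Gram entries. *)
rewrite /K rmorphB !rmorphM /= -!formC !DeltaE /gram_det; ring.
Qed.

(** Both sides equal the Gram determinant over [h x x * h y y * h z z]: its two cyclic terms give
    [Theta], and the others the three [qspread] terms minus 2. *)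
Lemma quadrance_identity x y z s :
  nonnull h x -> nonnull h y -> nonnull h z ->
  Delta h x y * Delta h y z * s = h y y * gram_det x y z ->
  qspread h x y * qspread h y z * s
    = qspread h x y + qspread h y z + qspread h z x - 2 + Theta h x y z.
Proof.
rewrite /nonnull => xnn ynn znn Ds.
have -> : qspread h x y * qspread h y z * s
    = gram_det x y z / (h x x * h y y * h z z).
  apply: (mulfI ynn); rewrite [RHS]mulrA -Ds /qspread.
  by field; rewrite xnn ynn znn.
rewrite /qspread /Theta /Omega !DeltaE /gram_det fmorph_div !rmorphM /= -!formC.
by field; rewrite xnn ynn znn.
Qed.
End HermitianThreeSpace.


Theorem theorem10p5 (R : realType) (V : vectType R[i])
    (h : hermitian_form R[i] V) (z1 z2 z3 p1 p3 : V)
    (dimV : \dim {:V} = 3%N)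
    (sigh : signature_of h 2 1)
    (freez : free [:: z1; z2; z3])
    (z1nn : nonnull h z1) (z2nn : nonnull h z2) (z3nn : nonnull h z3)
    (nd12 : nondegenerate_on h <<[:: z1; z2]>>%VS)
    (nd23 : nondegenerate_on h <<[:: z2; z3]>>%VS)
    (p3neq0 : p3 != 0) (p3z1 : h p3 z1 = 0) (p3z2 : h p3 z2 = 0)
    (p1neq0 : p1 != 0) (p1z2 : h p1 z2 = 0) (p1z3 : h p1 z3 = 0)
    (p1nn : nonnull h p1) (p3nn : nonnull h p3) :
  let s2 := 1 - `|h p3 p1| ^+ 2 / (h p3 p3 * h p1 p1) in
  qspread h z1 z2 * qspread h z2 z3 * s2
    = qspread h z1 z2 + qspread h z2 z3 + qspread h z3 z1 - 2
      + Theta h z1 z2 z3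
  /\ Delta h z1 z2 * Delta h z2 z3 * s2
    = h z2 z2 * \det (gram h [tuple z1; z2; z3]).
Proof.
(* Three independent vectors in dimension 3 span the space, so [p1] and [p3] have coordinates in
   them. *)
have span_full : <<[:: z1; z2; z3]>>%VS = fullv.
  by apply/eqP; rewrite eqEdim subvf dimV (eqP freez).
have in_span v : v \in <<[:: z1; z2; z3]>>%VS by rewrite span_full memvf.
have free12 : free [:: z1; z2].
  by move: freez; rewrite -[[:: z1; z2; z3]]/([:: z1; z2] ++ [:: z3]) => /catl_free.
have D12 := Delta_neq0 _ _ _ _ _ free12 z2nn nd12.
move=> s2; have main : Delta h z1 z2 * Delta h z2 z3 * s2
    = h z2 z2 * gram_det _ _ h z1 z2 z3 by exact: spread_identity.
by split; [exact: quadrance_identity | rewrite det_gram3].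
Qed.
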